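(* For every integer $d\geq 1$, $\alpha_{\mathbb{R}}^\ast(d) = \alpha_{\mathbb{R}}(d)$, i.e. \[ \max_{ \substack{D\in\mathbb{R}^{d\times d} \text{ diagonal},\ D \succeq 0,\ \|D\|_F^2 = d } }\mathbb{E}\left[ \frac1d\sum_{k=1}^d\sigma_k(GD)\right] = \mathbb{E}\left[ \frac1d\sum_{k=1}^d\sigma_k(G)\right], \] where $G\in\mathbb{R}^{d\times d}$ has i.i.d. real $\mathcal{N}\left(0,\frac1d\right)$ entries.
   Context: $\sigma_k(A)$ denotes the $k$-th singular value of $A$. $\alpha_{\mathbb{R}}(d)=\mathbb{E}\left[\frac1d\sum_{k=1}^d\sigma_k(G)\right]$ and $\alpha^\ast_{\mathbb{R}}(d)$ is the maximum on the left-hand side, over nonnegative diagonal $D$ with $\|D\|_F^2=d$. *)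

(* Defs.v *)
From HB Require Import structures.
From mathcomp Require Import all_boot all_order all_algebra.
From mathcomp Require Import all_classical all_reals all_analysis.
Set Implicit Arguments. Unset Strict Implicit. Unset Printing Implicit Defensive.
Import Order.TTheory GRing.Theory Num.Theory.
Local Open Scope classical_set_scope.
Local Open Scope ring_scope.

(* Eigenvalues (with multiplicity) of the Gram matrix A^T A: a list s such that
   the characteristic polynomial of A^T A splits as \prod_(x <- s) ('X - x).
   Such a list exists since A^T A is real symmetric; it is unique up to order.
   (If no such list existed, the default [::] is used.) *)
Definition gram_eigenvalues {R : realType} {n : nat} (A : 'M[R]_n) : seq R :=
  xget [::] [set s : seq R |
    char_poly (A^T *m A) = \prod_(x <- s) ('X - x%:P)].

Definition sum_singular_values {R : realType} {n : nat} (A : 'M[R]_n) : R :=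
  \sum_(x <- gram_eigenvalues A) Num.sqrt x.

Definition mutually_independent {R : realType} {d0 : measure_display}
    {T : measurableType d0} (P : probability T R) (I : finType)
    (X : I -> T -> R) : Prop :=
  forall B : I -> set R, (forall i, measurable (B i)) ->
    P (\bigcap_(i in [set: I]) (X i @^-1` B i)) =
    (\prod_(i : I) P (X i @^-1` B i))%E.

(* X has the real normal law N(m, s^2) (s = standard deviation). *)
Definition normally_distributed {R : realType} {d0 : measure_display}
    {T : measurableType d0} (P : probability T R) (X : T -> R) (m s : R) : Prop :=
  measurable_fun setT X /\
  forall B : set R, measurable B -> P (X @^-1` B) = normal_prob m s B.

Definition admissible_diag {R : realType} {d : nat} (D : 'M[R]_d) : Prop :=
  is_diag_mx D /\ (forall i, 0 <= D i i) /\
  \sum_(i < d) \sum_(j < d) D i j ^+ 2 = d%:R.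

Definition expected_avg_sv {R : realType} {d0 : measure_display}
    {T : measurableType d0} (P : probability T R) {d : nat}
    (G : T -> 'M[R]_d) (D : 'M[R]_d) : \bar R :=
  (\int[P]_w ((d%:R)^-1 * sum_singular_values (G w *m D))%:E)%E.

(* Main.v *)
Require Import Defs.
From HB Require Import structures.
From mathcomp Require Import all_boot all_order all_algebra perm complex.
From mathcomp Require Import all_classical all_reals all_analysis.
From mathcomp Require Import measurable_realfun.
From mathcomp Require Import ring lra.
Set Implicit Arguments. Unset Strict Implicit. Unset Printing Implicit Defensive.
Import Order.TTheory GRing.Theory Num.Theory.
Local Open Scope classical_set_scope.
Local Open Scope ring_scope.

(* For a square matrix A, the sum of the singular values is the minimum over
   orthogonal W of the sum of the Euclidean norms of the rows of W A.  Fix a W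
   that is optimal for G.  The norm of a row of W G diag(v) is the square root
   of a linear form in the squares v_i^2, so by concavity of the square root the
   average of sum_k sigma_k(G diag(v')) over the cyclic shifts v' of v is at most
   the value at the constant vector.  The columns of G are exchangeable, so all
   these shifts have the same expectation, and the inequality follows.

   The nuclear norm is Lipschitz in the entries.  Rounding the entries of G to a
   grid therefore reduces its measurability and the invariance of its
   expectation to random variables with countably many values. *)

(** * The real spectral theorem *)

Lemma mulmx_tr_ge0 (R : realDomainType) n (v : 'rV[R]_n) : 0 <= (v *m v^T) 0 0.
Proof. by rewrite mxE sumr_ge0// => i _; rewrite mxE -expr2 sqr_ge0. Qed.

Lemma mulmx_tr_eq0 (R : realDomainType) n (v : 'rV[R]_n) :
  ((v *m v^T) 0 0 == 0) = (v == 0).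
Proof.
apply/idP/eqP => [|->]; last by rewrite mul0mx mxE.
rewrite mxE psumr_eq0 => [/allP v0|i _]; last by rewrite mxE -expr2 sqr_ge0.
apply/rowP => i; move: (v0 i (mem_index_enum _)).
by rewrite !mxE mulf_eq0 orbb => /eqP.
Qed.

Lemma dot_symm (R : comNzRingType) n (S : 'M[R]_n) (u v : 'rV[R]_n) :
  S^T = S -> (u *m S *m v^T) 0 0 = (v *m S *m u^T) 0 0.
Proof.
move=> Ssym; transitivity ((u *m S *m v^T)^T 0 0); first by rewrite [RHS]mxE.
by rewrite !trmx_mul trmxK Ssym mulmxA.
Qed.

(** Both sides come from the determinant of the block matrix [M]. Clearing its lower left block by
    column operations gives [det('X - A B)]; clearing it by row operations, after scaling the lower
    rows by ['X], gives [det('X - B A)] times a power of ['X] that cancels. *)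
Lemma char_poly_mulC (R : idomainType) n (A B : 'M[R]_n) :
  char_poly (A *m B) = char_poly (B *m A).
Proof.
pose A' := map_mx polyC A; pose B' := map_mx polyC B.
pose M := block_mx 'X%:M A' B' 1%:M.
have MAB : M *m block_mx 1%:M 0 (- B') 1%:M =
    block_mx ('X%:M - A' *m B') A' 0 1%:M.
  by rewrite mulmx_block !mulmx1 !mulmx0 !add0r mul1mx mulmxN subrr.
have MBA : block_mx 1%:M 0 (- B') 'X%:M *m M =
    block_mx 'X%:M A' 0 ('X%:M - B' *m A').
  rewrite mulmx_block !mul1mx !mul0mx !addr0 mulmx1 !mulNmx.
  by rewrite [B' *m 'X%:M]mul_mx_scalar mul_scalar_mx addNr addrC.
have /(congr1 determinant) := MAB; have /(congr1 determinant) := MBA.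
rewrite !det_mulmx !det_lblock !det_ublock !det1 !mul1r !mulr1 det_scalar.
move=> /(mulfI _) ->; last by rewrite expf_neq0// polyX_eq0.
by rewrite /char_poly /char_poly_mx !map_mxM.
Qed.

(** Take a complex eigenvector [x + iy] with eigenvalue [a + ib]. Comparing [x S y^T] with [y S x^T]
    gives [b (|x|^2 + |y|^2) = 0], so [b = 0], and whichever of [x], [y] is nonzero is a real
    eigenvector. *)
Lemma symm_eigenvector (R : rcfType) n (S : 'M[R]_n.+1) : S^T = S ->
  exists a, exists2 v : 'rV[R]_n.+1, v != 0 & v *m S = a *: v.
Proof.
move=> Ssym; pose c := real_complex R.
have [z] := @eigenvalue_closed (R[i])%C _ (map_mx c S) isT.
move=> /eigenvalueP[w wS w0].
pose x := map_mx (@complex.Re R) w; pose y := map_mx (@complex.Im R) w.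
case: z wS => a b wS.
have ReM (f : 'I_n.+1 -> R[i]%C) :
    complex.Re (\sum_i f i) = \sum_i complex.Re (f i).
  by apply: (big_morph (@complex.Re R)) => // -[? ?] [? ?].
have ImM (f : 'I_n.+1 -> R[i]%C) :
    complex.Im (\sum_i f i) = \sum_i complex.Im (f i).
  by apply: (big_morph (@complex.Im R)) => // -[? ?] [? ?].
have xS : x *m S = a *: x - b *: y.
  apply/rowP => j; move/rowP/(_ j)/(congr1 (@complex.Re R)): wS.
  rewrite !mxE ReM => e; transitivity (complex.Re ((a +i* b)%C * w 0 j)).
    rewrite -e; apply: eq_bigr => i _; rewrite !mxE /c.
    by case: (w 0 i) => p q /=; rewrite mulr0 subr0.
  by case: (w 0 j).
have yS : y *m S = a *: y + b *: x.
  apply/rowP => j; move/rowP/(_ j)/(congr1 (@complex.Im R)): wS.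
  rewrite !mxE ImM => e; transitivity (complex.Im ((a +i* b)%C * w 0 j)).
    rewrite -e; apply: eq_bigr => i _; rewrite !mxE /c.
    by case: (w 0 i) => p q /=; rewrite mulr0 add0r.
  by case: (w 0 j).
have xy0 : (x != 0) || (y != 0).
  rewrite -negb_and; apply: contra w0 => /andP[/eqP x0 /eqP y0].
  apply/eqP/rowP => i; rewrite mxE.
  move/rowP/(_ i): x0; move/rowP/(_ i): y0; rewrite !mxE.
  by case: (w 0 i) => p q /= -> ->.
have b0 : b = 0.
  have := dot_symm x y Ssym.
  rewrite xS yS mulmxBl mulmxDl -!scalemxAl.
  have -> : x *m y^T = (x *m y^T)^T by apply/rowP=> i; rewrite !mxE !ord1.
  rewrite trmx_mul trmxK !mxE.
  have -> : \sum_j y 0 j * y^T j 0 = (y *m y^T) 0 0 by rewrite mxE.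
  have -> : \sum_j x 0 j * x^T j 0 = (x *m x^T) 0 0 by rewrite mxE.
  move=> /addrI/eqP; rewrite eq_sym -subr_eq0 opprK -mulrDr mulf_eq0.
  rewrite paddr_eq0 ?mulmx_tr_ge0// !mulmx_tr_eq0.
  by case/orP => [/eqP//|]; rewrite -[_ && _]negbK negb_and xy0.
exists a; case/orP: xy0 => [x0|y0]; [exists x => //|exists y => //].
  by rewrite xS b0 scale0r subr0.
by rewrite yS b0 scale0r addr0.
Qed.

(* H is the Householder reflection exchanging v and the first basis vector. *)
Lemma orthogonal_with_row0 (R : realFieldType) n (v : 'rV[R]_n.+1) :
  v *m v^T = 1%:M -> exists2 H : 'M[R]_n.+1, H *m H^T = 1%:M & row 0 H = v.
Proof.
move=> vv; pose e : 'rV[R]_n.+1 := delta_mx 0 0.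
have [u uE] : exists u, u = v - e by exists (v - e).
(* If [v] is already the first basis vector, there is no direction to reflect along, and the
   identity serves. *)
have [/eqP|u0] := eqVneq u 0.
  rewrite uE subr_eq0 => /eqP ->; exists 1%:M; first by rewrite trmx1 mulmx1.
  by rewrite row1.
pose q := (u *m u^T) 0 0.
have q0 : q != 0 by rewrite mulmx_tr_eq0.
have uuE : u *m u^T = q%:M by rewrite [LHS]mx11_scalar.
pose H : 'M[R]_n.+1 := 1%:M - (2 / q) *: (u^T *m u).
have HT : H^T = H by rewrite /H linearB/= trmx1 linearZ/= trmx_mul trmxK.
exists H.
  rewrite HT /H mulmxBl mul1mx mulmxBr mulmx1 -scalemxAl -scalemxAr mulmxA.
  rewrite -[u^T *m u *m u^T]mulmxA uuE mul_mx_scalar -scalemxAl !scalerA.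
  rewrite -addrA -opprD -scalerBl -scalerDl -[RHS]subr0; congr (_ - _).
  by apply/eqP; rewrite scaler_eq0; apply/orP; left; apply/eqP; field.
have e_row (A : 'M[R]_n.+1) : row 0 A = e *m A by rewrite -rowE.
rewrite e_row /H mulmxBr mulmx1 -scalemxAr mulmxA.
have ee : e *m e^T = 1%:M.
  by rewrite [LHS]mx11_scalar -rowE; congr _%:M; rewrite !mxE !eqxx.
pose t := (e *m v^T) 0 0.
have ev : e *m v^T = t%:M by rewrite [LHS]mx11_scalar.
have ve : v *m e^T = t%:M by rewrite -[LHS]trmxK trmx_mul trmxK ev tr_scalar_mx.
have eu : e *m u^T = (t - 1)%:M.
  by rewrite uE linearB/= mulmxBr ee ev -raddfB.
have qE : q = 2 - 2 * t.
  rewrite /q uE linearB/= mulmxBl !mulmxBr ee ve ev vv !mxE !eqxx !mulr1n; ring.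
rewrite eu mul_scalar_mx scalerA.
have -> : 2 / q * (t - 1) = -1.
  by have := q0; rewrite qE => q0'; field; move: q0'; apply: contra => /eqP h;
  apply/eqP; rewrite -h; ring.
by rewrite scaleN1r opprK uE addrC subrK.
Qed.

(** Deflation: a unit eigenvector is completed to an orthogonal [H]. Conjugating by [H] makes the
    first row a multiple of the first basis vector, hence the first column too by symmetry, and the
    induction hypothesis applies to the remaining block. *)
Theorem real_spectral (R : rcfType) n (S : 'M[R]_n) : S^T = S ->
  exists Q : 'M[R]_n, exists2 l : 'rV[R]_n,
    Q *m Q^T = 1%:M & S = Q^T *m diag_mx l *m Q.
Proof.
elim: n S => [|n IHn] S Ssym.
  by exists 1%:M, 0; apply/matrixP => -[].
have [a [v v0 vS]] := symm_eigenvector Ssym.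
have [q q0 vvE] : exists2 q, 0 < q & v *m v^T = q%:M.
  exists ((v *m v^T) 0 0); last exact: mx11_scalar.
  by rewrite lt_def mulmx_tr_eq0 v0 mulmx_tr_ge0.
pose w := (Num.sqrt q)^-1 *: v.
have wS : w *m S = a *: w by rewrite -scalemxAl vS !scalerA mulrC.
have ww : w *m w^T = 1%:M.
  rewrite linearZ/= -scalemxAr -scalemxAl scalerA vvE scale_scalar_mx.
  by rewrite -invfM -expr2 sqr_sqrtr ?ltW// mulVf// gt_eqF.
have [H HH H0] := orthogonal_with_row0 ww.
have HH' : H^T *m H = 1%:M by exact: mulmx1C.
pose S1 : 'M[R]_(1 + n) := H *m S *m H^T.
have S1sym : S1^T = S1 by rewrite /S1 !trmx_mul trmxK Ssym mulmxA.
have S1row : row 0 S1 = a *: delta_mx 0 0.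
  by rewrite /S1 !row_mul H0 wS -scalemxAl -H0 -row_mul HH row1.
have SE : S = H^T *m S1 *m H.
  by rewrite /S1 !mulmxA HH' mul1mx -mulmxA HH' mulmx1.
clearbody S1; pose S' := drsubmx S1.
have S1E : S1 = block_mx a%:M 0 0 S'.
  have ur : ursubmx S1 = 0.
    apply/matrixP => i j; rewrite !mxE ord1.
    move/rowP/(_ (rshift 1 j)): S1row; rewrite !mxE.
    by rewrite (_ : lshift n 0 = 0) ?mulr0//; apply: val_inj.
  rewrite -[LHS]submxK; congr block_mx => //.
    apply/matrixP => i j; rewrite !mxE !ord1.
    move/rowP/(_ 0): S1row; rewrite !mxE eqxx mulr1 => <-.
    by rewrite (_ : lshift n 0 = 0)//; apply: val_inj.
  by rewrite -[LHS]trmxK trmx_dlsub S1sym ur trmx0.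
have S'sym : S'^T = S' by rewrite trmx_drsub S1sym.
have [P [l PP S'E]] := IHn _ S'sym.
pose P1 : 'M[R]_(1 + n) := block_mx 1%:M 0 0 P.
have P1T : P1^T = block_mx 1%:M 0 0 P^T by rewrite tr_block_mx trmx1 !trmx0.
have P1P : P1 *m P1^T = 1%:M.
  by rewrite P1T mulmx_block !mulmx0 !mul0mx mulmx1 !addr0 add0r PP -scalar_mx_block.
have dl : diag_mx (row_mx (a%:M : 'M[R]_1) l) = block_mx a%:M 0 0 (diag_mx l).
  rewrite (diag_mx_row (a%:M : 'rV_1) l); congr block_mx.
  by apply/matrixP => i j; rewrite !mxE !ord1.
have S1P : S1 = P1^T *m diag_mx (row_mx (a%:M : 'M[R]_1) l) *m P1.
  rewrite S1E P1T dl !mulmx_block !mulmx0 !mul0mx mulmx1 mul1mx !addr0 !add0r.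
  by rewrite !mul0mx -S'E.
exists (P1 *m H : 'M[R]_n.+1), (row_mx (a%:M : 'M[R]_1) l).
  by rewrite trmx_mul mulmxA -[P1 *m H *m _]mulmxA HH mulmx1 P1P.
rewrite SE S1P trmx_mul -!mulmxA; congr (_ *m _).
Qed.

(** * Sums of singular values *)

(** The sum of the squares [(B a_i - C b_i)^2] equals [B (A B - C^2)], which settles the case
    [B > 0]; if [B = 0], every [b_i] vanishes. *)
Lemma cauchy_schwarz (R : rcfType) (I : finType) (a b : I -> R) :
  \sum_i a i * b i <=
  Num.sqrt (\sum_i a i ^+ 2) * Num.sqrt (\sum_i b i ^+ 2).
Proof.
set A := \sum_i a i ^+ 2; set B := \sum_i b i ^+ 2; set C := \sum_i a i * b i.
have A0 : 0 <= A by apply: sumr_ge0 => i _; exact: sqr_ge0.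
have B0 : 0 <= B by apply: sumr_ge0 => i _; exact: sqr_ge0.
suff CAB : C ^+ 2 <= A * B.
  rewrite -sqrtrM// (le_trans (ler_norm _))// -sqrtr_sqr.
  by rewrite ler_wsqrtr.
have [b0|b_neq0] := eqVneq B 0.
  have -> : C = 0; last by rewrite b0 mulr0 expr0n.
  apply: big1 => i _; have /eqP := b0.
  rewrite psumr_eq0 => [/allP/(_ i (mem_index_enum _))|j _]; last exact: sqr_ge0.
  by rewrite sqrf_eq0 => /eqP ->; rewrite mulr0.
have : 0 <= \sum_i (B * a i - C * b i) ^+ 2.
  by apply: sumr_ge0 => i _; exact: sqr_ge0.
have -> : \sum_i (B * a i - C * b i) ^+ 2 =
    B * (A * B - C ^+ 2).
  transitivity (\sum_i (B ^+ 2 * a i ^+ 2 - 2 * B * C * (a i * b i) +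
      C ^+ 2 * b i ^+ 2)); first by apply: eq_bigr => i _; ring.
  by rewrite big_split/= sumrB -!mulr_sumr -/A -/B -/C; ring.
by rewrite pmulr_rge0 ?subr_ge0// lt_def b_neq0.
Qed.

Definition row_norm (R : rcfType) m n (A : 'M[R]_(m, n)) (i : 'I_m) : R :=
  Num.sqrt (\sum_j A i j ^+ 2).

Lemma row_norm_tr (R : rcfType) m n (A : 'M[R]_(m, n)) i :
  row_norm A i = Num.sqrt ((A *m A^T) i i).
Proof.
by rewrite mxE; congr Num.sqrt; apply: eq_bigr => j _; rewrite mxE expr2.
Qed.

Lemma row_normD (R : rcfType) m n (A B : 'M[R]_(m, n)) i :
  row_norm (A + B) i <= row_norm A i + row_norm B i.
Proof.
have nn0 (C : 'M[R]_(m, n)) : 0 <= \sum_j C i j ^+ 2.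
  by apply: sumr_ge0 => j _; exact: sqr_ge0.
rewrite -[leRHS]ger0_norm ?addr_ge0 ?sqrtr_ge0// -sqrtr_sqr ler_wsqrtr//.
rewrite sqrrD !sqr_sqrtr// addrAC -lerBlDl.
have := cauchy_schwarz (A i) (B i).
rewrite -/(row_norm A i) -/(row_norm B i) => AB.
rewrite (_ : _ - _ = (\sum_j A i j * B i j) *+ 2) ?lerMn2r//.
rewrite -big_split -sumrB -sumrMnl.
by apply: eq_bigr => j _; rewrite !mxE/=; ring.
Qed.

Section SingularValues.
Variables (R : realType) (n : nat).
Implicit Types A B Q V W : 'M[R]_n.

(** The entries of [l] show that a list of roots exists, so [xget] does not fall back on [[::]]. By
    unique factorisation the list it picks is a permutation of them, which the sum does not see. *)
Lemma sum_singular_values_char_poly A (l : 'rV[R]_n) :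
  char_poly (A^T *m A) = char_poly (diag_mx l) ->
  sum_singular_values A = \sum_i Num.sqrt (l 0 i).
Proof.
rewrite (char_poly_trig (diag_mx_is_trig l)) => Al.
have Al' : char_poly (A^T *m A) =
    \prod_(x <- [seq l 0 i | i <- index_enum 'I_n]) ('X - x%:P).
  by rewrite Al big_map; apply: eq_bigr => i _; rewrite mxE eqxx.
have := @xgetPex _ [::] [set s : seq R |
  char_poly (A^T *m A) = \prod_(x <- s) ('X - x%:P)] (ex_intro _ _ Al').
rewrite /= -/(gram_eigenvalues A) Al' => /esym/prod_XsubC_eq p.
by rewrite /sum_singular_values (perm_big _ p) big_map.
Qed.

Lemma char_poly_orthoC Q (l : 'rV[R]_n) : Q *m Q^T = 1%:M ->
  char_poly (Q^T *m diag_mx l *m Q) = char_poly (diag_mx l).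
Proof. by move=> QQ; rewrite char_poly_mulC mulmxA QQ mul1mx. Qed.

Lemma eq_sum_singular_values A B :
  char_poly (A^T *m A) = char_poly (B^T *m B) ->
  sum_singular_values A = sum_singular_values B.
Proof.
by move=> AB; rewrite /sum_singular_values /gram_eigenvalues AB.
Qed.

Lemma sum_singular_values_orthol A W : W *m W^T = 1%:M ->
  sum_singular_values (W *m A) = sum_singular_values A.
Proof.
move=> /mulmx1C WW; apply: eq_sum_singular_values.
by rewrite trmx_mul -mulmxA [W^T *m _]mulmxA WW mul1mx.
Qed.

Lemma sum_singular_values_orthor A V : V *m V^T = 1%:M ->
  sum_singular_values (A *m V) = sum_singular_values A.
Proof.
move=> VV; apply: eq_sum_singular_values.
by rewrite trmx_mul mulmxA char_poly_mulC !mulmxA VV mul1mx.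
Qed.

(** In an orthonormal eigenbasis [Q] of [A^T A], the matrix [C = A Q^T] has orthogonal columns of
    squared length [l_i] and the same row norms as [A]. The sum of singular values is the entrywise
    pairing of [C] with a matrix whose rows have norm at most 1, and Cauchy-Schwarz is applied to
    each row. *)
Lemma sum_singular_values_le_row_norm A :
  sum_singular_values A <= \sum_j row_norm A j.
Proof.
have Gsym : (A^T *m A)^T = A^T *m A by rewrite trmx_mul trmxK.
have [Q [l QQ AE]] := real_spectral Gsym.
rewrite (@sum_singular_values_char_poly _ l) ?AE ?char_poly_orthoC//.
have [C CE] : exists C, C = A *m Q^T by exists (A *m Q^T).
have CC : C^T *m C = diag_mx l.
  rewrite CE trmx_mul trmxK mulmxA -[Q *m A^T *m A]mulmxA AE.
  by rewrite !mulmxA QQ mul1mx -mulmxA QQ mulmx1.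
have CnormE j : row_norm C j = row_norm A j.
  rewrite !row_norm_tr CE trmx_mul trmxK mulmxA -[A *m Q^T *m Q]mulmxA.
  by rewrite (mulmx1C QQ) mulmx1.
have lE i : l 0 i = \sum_j C j i ^+ 2.
  transitivity ((C^T *m C) i i); first by rewrite CC mxE eqxx.
  by rewrite mxE; apply: eq_bigr => j _; rewrite mxE expr2.
have l0 i : 0 <= l 0 i by rewrite lE sumr_ge0// => j _; exact: sqr_ge0.
(* As the inverse of 0 is 0, the directions with [l_i = 0] are sent to 0. *)
have [s sE] : exists s : 'rV[R]_n, s = \row_i (Num.sqrt (l 0 i))^-1.
  by exists (\row_i (Num.sqrt (l 0 i))^-1).
(* B is the partial isometry of the polar decomposition, expressed in the basis
   Q; its rows have norm at most 1 because B B^T is a projection. *)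
have [B BE] : exists B, B = C *m diag_mx s by exists (C *m diag_mx s).
have BBB : B *m B^T *m B = B.
  rewrite {2 3}BE trmx_mul tr_diag_mx !mulmxA -[_ *m C^T *m C]mulmxA CC.
  rewrite BE -!mulmxA !mulmx_diag; congr (_ *m diag_mx _).
  apply/rowP => i; rewrite !sE !mxE.
  have /esym := sqr_sqrtr (l0 i); move: (Num.sqrt _) => t ->.
  by have [->|t0] := eqVneq t 0; [rewrite invr0 !mul0r | field].
have Bnorm j : row_norm B j <= 1.
  rewrite row_norm_tr -[leRHS]sqrtr1 ler_wsqrtr//.
  set E := B *m B^T; have EE : E *m E = E by rewrite /E mulmxA BBB.
  have ET : E^T = E by rewrite /E trmx_mul trmxK.
  (* For a symmetric idempotent, [E_jj] is the sum over [k] of [E_jk^2], which contains [E_jj^2];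
     hence [E_jj <= 1]. *)
  clearbody E; have : E j j ^+ 2 <= E j j.
    rewrite -[in leRHS]EE -[in X in X *m _]ET mxE (bigD1 j)//= mxE -expr2.
    rewrite lerDl sumr_ge0// => k _; rewrite mxE -expr2; exact: sqr_ge0.
  nra.
suff -> : \sum_i Num.sqrt (l 0 i) = \sum_j \sum_i B j i * C j i.
  apply: ler_sum => j _; rewrite (le_trans (cauchy_schwarz _ _))//.
  by rewrite -/(row_norm B j) -/(row_norm C j) CnormE ler_piMl// sqrtr_ge0.
rewrite exchange_big; apply: eq_bigr => i _/=.
transitivity ((Num.sqrt (l 0 i))^-1 * \sum_j C j i ^+ 2).
  rewrite -lE; have /esym := sqr_sqrtr (l0 i); move: (Num.sqrt _) => t ->.
  by have [->|t0] := eqVneq t 0; [rewrite expr0n mulr0 | field].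
rewrite mulr_sumr; apply: eq_bigr => j _.
by rewrite BE mul_mx_diag !mxE sE mxE; ring.
Qed.

(** Equality holds when [W] diagonalises [A A^T]: the squared row norms of [W A] are then the
    eigenvalues of [A A^T], which are those of [A^T A]. *)
Lemma sum_singular_values_row_norm A : exists2 W : 'M[R]_n,
  W *m W^T = 1%:M & sum_singular_values A = \sum_j row_norm (W *m A) j.
Proof.
have Gsym : (A *m A^T)^T = A *m A^T by rewrite trmx_mul trmxK.
have [Q [l QQ AE]] := real_spectral Gsym.
exists Q => //; rewrite (@sum_singular_values_char_poly _ l).
  apply: eq_bigr => j _; rewrite row_norm_tr trmx_mul mulmxA.
  rewrite -[Q *m A *m A^T]mulmxA AE !mulmxA QQ mul1mx -mulmxA QQ mulmx1.
  by rewrite mxE eqxx.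
by rewrite char_poly_mulC AE char_poly_orthoC.
Qed.

Lemma sum_singular_values_ge0 A : 0 <= sum_singular_values A.
Proof. by apply: sumr_ge0 => x _; exact: sqrtr_ge0. Qed.

(** A [W] optimal for [B] still gives an upper bound for [A], so the difference is at most the sum
    of the row norms of [W (A - B)]. Entries of [W] are at most 1 in absolute value, so those of
    [W (A - B)] are at most [n e]; each row norm is crudely at most [n (n e)], and there are [n]
    rows. *)
Lemma sum_singular_values_lipschitz A B (e : R) :
  (forall i j, `|A i j - B i j| <= e) ->
  sum_singular_values A <= sum_singular_values B + n%:R ^+ 3 * e.
Proof.
move=> ABe; have [W WW ->] := sum_singular_values_row_norm B.
rewrite -(sum_singular_values_orthol A WW).
rewrite (le_trans (sum_singular_values_le_row_norm _))//.
have -> : n%:R ^+ 3 * e = \sum_(j < n) (n%:R * (n%:R * e)).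
  by rewrite sumr_const card_ord -[RHS]mulr_natl; ring.
rewrite -big_split/=; apply: ler_sum => j _.
rewrite -[W *m A](subrK (W *m B)) -mulmxBr.
rewrite (le_trans (row_normD _ _ _))// [leLHS]addrC lerD2l.
have e0 : 0 <= e by rewrite (le_trans _ (ABe j j)).
have W1 k : `|W j k| <= 1.
  rewrite -(@expr_le1 _ 2)// -normrX ger0_norm ?sqr_ge0//.
  have <- : (W *m W^T) j j = 1 by rewrite WW mxE eqxx.
  rewrite mxE (bigD1 k)//= mxE -expr2 lerDl sumr_ge0// => i _.
  by rewrite mxE -expr2 sqr_ge0.
have C1 k : `|(W *m (A - B)) j k| <= n%:R * e.
  rewrite mxE (le_trans (ler_norm_sum _ _ _))//.
  rewrite mulr_natl -[n in _ *+ n]card_ord -sumr_const ler_sum// => i _.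
  rewrite normrM (le_trans (ler_piMl _ (W1 i)))// !mxE; exact: ABe.
rewrite -[leRHS]ger0_norm ?mulr_ge0// -sqrtr_sqr ler_wsqrtr//.
rewrite exprMn (le_trans (_ : _ <= n%:R * (n%:R * e) ^+ 2))//; last first.
  rewrite ler_wpM2r ?sqr_ge0// expr2 -natrM ler_nat.
  by case: (n) => // ?; rewrite leq_pmull.
rewrite [leRHS]mulr_natl -[n in _ *+ n]card_ord -sumr_const ler_sum// => k _.
by rewrite -[leLHS]ger0_norm ?sqr_ge0// normrX lerXn2r// nnegrE mulr_ge0.
Qed.

Lemma sum_singular_values_avg m A (d : 'I_m -> 'rV[R]_n) :
  (forall i, \sum_k d k 0 i ^+ 2 = m%:R) ->
  \sum_k sum_singular_values (A *m diag_mx (d k)) <=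
    m%:R * sum_singular_values A.
Proof.
move=> dm; have [W WW ->] := sum_singular_values_row_norm A.
have le1 k : sum_singular_values (A *m diag_mx (d k)) <=
    \sum_j row_norm (W *m A *m diag_mx (d k)) j.
  rewrite -(sum_singular_values_orthol _ WW) mulmxA.
  exact: sum_singular_values_le_row_norm.
rewrite (le_trans (ler_sum _ (fun k _ => le1 k)))// exchange_big mulr_sumr/=.
apply: ler_sum => j _; move: (W *m A) => C {le1}.
(* Pairing with the constant 1 is the concavity of the square root; the squared norms of row [j] sum
   over [k] to [m] times that of [C]. *)
have := cauchy_schwarz (fun k => row_norm (C *m diag_mx (d k)) j) (fun=> 1).
under [leLHS]eq_bigr do rewrite mulr1.
move=> /le_trans; apply; rewrite expr1n sumr_const card_ord.
have -> : \sum_k row_norm (C *m diag_mx (d k)) j ^+ 2 =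
    m%:R * \sum_i C j i ^+ 2; last first.
  by rewrite sqrtrM// mulrAC -expr2 sqr_sqrtr.
rewrite mulr_sumr.
transitivity (\sum_k \sum_i d k 0 i ^+ 2 * C j i ^+ 2).
  apply: eq_bigr => k _; rewrite sqr_sqrtr; last first.
    by apply: sumr_ge0 => i _; exact: sqr_ge0.
  by apply: eq_bigr => i _; rewrite mul_mx_diag mxE exprMn mulrC.
by rewrite exchange_big; apply: eq_bigr => i _; rewrite -mulr_suml dm.
Qed.

End SingularValues.

(** * Lipschitz functions of independent random variables *)

Section CountableValues.
Context {R : realType} {d : measure_display} {T : measurableType d}.
Variables (P : probability T R) (C : countType).
Implicit Types h : T -> C.

(** [C] carries no sigma-algebra, so its values are transported to [nat]. [pickle_inv] rejects the
    integers that are not codes, whose fibre is empty. *)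
Lemma pickle_fiber h k : (pickle \o h) @^-1` [set k] =
  if pickle_inv k is Some c then h @^-1` [set c] else set0.
Proof.
have := @pickle_invK C k; case E : (pickle_inv k) => [c|] /= ck; last first.
  by apply/seteqP; split => // w /= wk; rewrite -wk pickleK_inv in E.
apply/seteqP; split => w /=; last by move=> ->.
by move=> wk; apply: Some_inj; rewrite -E -wk pickleK_inv.
Qed.

Lemma measurable_pickle h : (forall c, measurable (h @^-1` [set c])) ->
  measurable_fun [set: T] (pickle \o h).
Proof.
move=> mh _ A _; rewrite setTI -[A]image_id -bigcup_imset1 preimage_bigcup.
by apply: bigcup_measurable => k _; rewrite pickle_fiber; case: pickle_inv.
Qed.

Lemma measurable_fun_countable h (g : C -> R) :
  (forall c, measurable (h @^-1` [set c])) -> measurable_fun [set: T] (g \o h).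
Proof.
move=> mh; pose f k := if unpickle k is Some c then g c else 0.
have -> : g \o h = f \o (pickle \o h).
  by apply/funext => w; rewrite /f /= pickleK.
exact: measurableT_comp (measurable_pickle mh).
Qed.

(** Both integrals are integrals over [nat] against the law of the code, and countable additivity
    determines that law by its point masses. *)
Lemma integral_countable_law h1 h2 (g : C -> R) :
  (forall c, measurable (h1 @^-1` [set c])) ->
  (forall c, measurable (h2 @^-1` [set c])) ->
  (forall c, P (h1 @^-1` [set c]) = P (h2 @^-1` [set c])) ->
  (forall c, 0 <= g c) ->
  (\int[P]_w (g (h1 w))%:E = \int[P]_w (g (h2 w))%:E)%E.
Proof.
move=> mh1 mh2 h12 g0.
pose f k := (if unpickle k is Some c then g c else 0)%:E.
have f0 k : (0 <= f k)%E by rewrite lee_fin; case: unpickle.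
pose H h (mh : forall c, measurable (h @^-1` [set c])) : {mfun T >-> nat} :=
  HB.pack (pickle \o h) (isMeasurableFun.Build _ _ _ _ _ (measurable_pickle mh)).
have intE h mh :
    (\int[P]_w (g (h w))%:E = \int[distribution P (@H h mh)]_k f k)%E.
  rewrite ge0_integral_distribution//.
  by apply: eq_integral => w _; rewrite /f /= pickleK.
rewrite (intE _ mh1) (intE _ mh2); apply: eq_measure_integral => A _ _.
have distE h mh : distribution P (@H h mh) A =
    (\sum_(k <oo | k \in A)
      if pickle_inv k is Some c then P (h @^-1` [set c]) else 0)%E.
  rewrite -[A in LHS]image_id -bigcup_imset1 measure_bigcup//.
    apply: eq_eseriesr => k _; transitivity (P ((pickle \o h) @^-1` [set k])) => //.
    by rewrite pickle_fiber; case: pickle_inv => //; rewrite measure0.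
  by apply/trivIsetP => i j _ _ ij; apply/seteqP; split => // k [/= -> /eqP];
    rewrite (negbTE ij).
rewrite [LHS]distE [RHS]distE.
by apply: eq_eseriesr => k _; case: pickle_inv.
Qed.

End CountableValues.

Section Discretization.
Context {R : realType} {d : measure_display} {T : measurableType d}.
Variables (P : probability T R) (I : finType).
Implicit Types X Y : I -> T -> R.

(** Integer codes in a finite function space form a countable type, as the previous section
    requires; the mesh is [1 / (n + 1)]. *)
Definition grid_code (n : nat) (x : I -> R) : {ffun I -> int} :=
  [ffun i => Num.floor (x i * n.+1%:R)].

Definition grid_point (n : nat) (z : {ffun I -> int}) (i : I) : R :=
  (z i)%:~R / n.+1%:R.

Lemma grid_point_close n (x : I -> R) i :
  `|x i - grid_point n (grid_code n x) i| <= n.+1%:R^-1.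
Proof.
have n0 : 0 < n.+1%:R :> R by rewrite ltr0n.
rewrite /grid_point ffunE -(ler_pM2r n0) mulVf ?gt_eqF//.
rewrite -[X in _ * X <= _](ger0_norm (ltW n0)) -normrM mulrBl divfK ?gt_eqF//.
have := floor_itv (x i * n.+1%:R).
by rewrite intrD => /andP[? ?]; rewrite ler_norml; apply/andP; split; lra.
Qed.

Definition grid_cell (n : nat) (z : int) : set R :=
  [set x | z%:~R <= x * n.+1%:R < (z + 1)%:~R].

Lemma measurable_grid_cell n z : measurable (grid_cell n z).
Proof.
rewrite (_ : grid_cell n z =
    [set` `[(z%:~R / n.+1%:R : R), ((z + 1)%:~R / n.+1%:R)[ ]) //.
by apply/seteqP; split => x /=; rewrite in_itv/= ler_pdivrMr// ltr_pdivlMr.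
Qed.

Lemma grid_code_fiber n X (c : {ffun I -> int}) :
  (fun w => grid_code n (X^~ w)) @^-1` [set c] =
  \bigcap_(i in [set: I]) (X i @^-1` grid_cell n (c i)).
Proof.
apply/seteqP; split => [w /= <- i _|w /= Xc].
  by rewrite ffunE /grid_cell/=; exact: floor_itv.
by apply/ffunP => i; rewrite ffunE; apply: floor_def; exact: Xc.
Qed.

Lemma measurable_grid_code_fiber n X c : (forall i, measurable_fun setT (X i)) ->
  measurable ((fun w => grid_code n (X^~ w)) @^-1` [set c]).
Proof.
move=> mX; rewrite grid_code_fiber; apply: fin_bigcap_measurable => // i _.
by rewrite -[_ @^-1` _]setTI; apply: mX => //; exact: measurable_grid_cell.
Qed.

(** A code is attained exactly when each coordinate lies in its cell, so independence reduces its
    probability to the marginal laws. *)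
Lemma grid_code_law n X Y c :
  mutually_independent P X -> mutually_independent P Y ->
  (forall i B, measurable B -> P (X i @^-1` B) = P (Y i @^-1` B)) ->
  P ((fun w => grid_code n (X^~ w)) @^-1` [set c]) =
  P ((fun w => grid_code n (Y^~ w)) @^-1` [set c]).
Proof.
move=> iX iY XY; rewrite !grid_code_fiber.
have mc i : measurable (grid_cell n (c i)) by exact: measurable_grid_cell.
rewrite (iX _ mc) (iY _ mc).
by apply: eq_bigr => i _; apply: XY; exact: measurable_grid_cell.
Qed.

Variables (F : (I -> R) -> R) (K : R).
Hypothesis F0 : forall x, 0 <= F x.
Hypothesis FK : forall x y (e : R), (forall i, `|x i - y i| <= e) ->
  F x <= F y + K * e.

Lemma grid_approx n (x : I -> R) :
  `|F x - F (grid_point n (grid_code n x))| <= K / n.+1%:R.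
Proof.
set y := grid_point n _; have xy i : `|x i - y i| <= n.+1%:R^-1.
  exact: grid_point_close.
have Fxy : F x <= F y + K / n.+1%:R by exact: FK.
have Fyx : F y <= F x + K / n.+1%:R by apply: FK => i; rewrite distrC.
by rewrite ler_distl lerBlDr Fxy Fyx.
Qed.

Lemma measurable_fun_grid n X : (forall i, measurable_fun setT (X i)) ->
  measurable_fun setT (fun w => F (grid_point n (grid_code n (X^~ w)))).
Proof.
move=> mX; apply: (@measurable_fun_countable _ _ _ _
  (fun w => grid_code n (X^~ w)) (fun c => F (grid_point n c))) => c.
exact: measurable_grid_code_fiber.
Qed.

(** The function is the pointwise limit of its rounded versions, each measurable because it factors
    through a countable code. *)
Lemma measurable_fun_lipschitz X : (forall i, measurable_fun setT (X i)) ->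
  measurable_fun setT (fun w => F (X^~ w)).
Proof.
move=> mX; apply: (@measurable_fun_cvg _ _ _ _
  (fun n w => F (grid_point n (grid_code n (X^~ w))))).
  by move=> n; exact: measurable_fun_grid.
move=> w _; apply/cvgrPdist_le => e e0; near=> n.
rewrite (le_trans (grid_approx _ _))// ler_pdivrMr ?ltr0n// mulrC.
rewrite -ler_pdivrMr// (le_trans (ltW (truncnS_gt _)))// ler_nat ltnS.
by near: n; exists (Num.truncn (K / e)).
Unshelve. all: by end_near. Qed.

(** Since [P] has mass 1, the constant integrates to itself; the integrals may be infinite. *)
Lemma le_integral_addr (f g : T -> R) (c : R) :
  measurable_fun setT f -> measurable_fun setT g ->
  (forall w, 0 <= f w) -> (forall w, 0 <= g w) -> 0 <= c ->
  (forall w, f w <= g w + c) ->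
  (\int[P]_w (f w)%:E <= \int[P]_w (g w)%:E + c%:E)%E.
Proof.
move=> mf mg f0 g0 c0 fgc.
have -> : (\int[P]_w (g w)%:E + c%:E = \int[P]_w ((g w)%:E + c%:E))%E.
  rewrite ge0_integralD//; first by rewrite integral_cst//= probability_setT mule1.
  - by move=> w _; rewrite lee_fin.
  - by move/measurable_EFinP : mg.
apply: ge0_le_integral => //.
- by move=> w _; rewrite lee_fin.
- by move/measurable_EFinP : mf.
- have /measurable_EFinP : measurable_fun setT (fun w => g w + c).
    exact: measurable_funD.
  by apply: eq_measurable_fun => w _.
- by move=> w _; rewrite -EFinD lee_fin.
Qed.

(** Round [X], exchange the rounded [X] for the rounded [Y], which has the same discrete law, and
    undo the rounding. Each rounding costs at most [e / 2]. *)
Lemma le_integral_same_law X Y :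
  (forall i, measurable_fun setT (X i)) ->
  (forall i, measurable_fun setT (Y i)) ->
  mutually_independent P X -> mutually_independent P Y ->
  (forall i B, measurable B -> P (X i @^-1` B) = P (Y i @^-1` B)) ->
  (\int[P]_w (F (X^~ w))%:E <= \int[P]_w (F (Y^~ w))%:E)%E.
Proof.
move=> mX mY iX iY XY; apply/lee_addgt0Pr => e e0.
pose n := Num.truncn (K / (e / 2)).
have Kn : K / n.+1%:R <= e / 2.
  rewrite ler_pdivrMr ?ltr0n// mulrC -ler_pdivrMr ?divr_gt0//.
  exact/ltW/truncnS_gt.
have e2 : 0 <= e / 2 by rewrite divr_ge0// ltW.
rewrite [e]splitr EFinD addeA.
have step1 : (\int[P]_w (F (X^~ w))%:E <=
    \int[P]_w (F (grid_point n (grid_code n (X^~ w))))%:E + (e / 2)%:E)%E.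
  apply: le_integral_addr => //.
  - exact: measurable_fun_lipschitz.
  - exact: measurable_fun_grid.
  - move=> w; have := grid_approx n (X^~ w); rewrite ler_distl => /andP[_].
    by move=> /le_trans; apply; rewrite lerD2l.
apply: (le_trans step1); rewrite leeD2r//.
rewrite (@integral_countable_law _ _ _ P _ (fun w => grid_code n (X^~ w))
  (fun w => grid_code n (Y^~ w)) (fun c => F (grid_point n c)))//.
- apply: le_integral_addr => //.
  - exact: measurable_fun_grid.
  - exact: measurable_fun_lipschitz.
  - move=> w; have := grid_approx n (Y^~ w); rewrite ler_distl lerBlDr => /andP[+ _].
    by move=> /le_trans; apply; rewrite lerD2l.
- by move=> c; exact: measurable_grid_code_fiber.
- by move=> c; exact: measurable_grid_code_fiber.
- by move=> c; exact: grid_code_law.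
Qed.

End Discretization.

(** * Averaging over cyclic shifts *)

Lemma mutually_independent_reindex (R : realType) (d : measure_display)
    (T : measurableType d) (P : probability T R) (I J : finType)
    (f : J -> I) (X : I -> T -> R) :
  bijective f -> mutually_independent P X ->
  mutually_independent P (fun j => X (f j)).
Proof.
move=> [g fK gK] iX B mB.
have -> : \bigcap_(j in [set: J]) (X (f j) @^-1` B j) =
    \bigcap_(i in [set: I]) (X i @^-1` B (g i)).
  apply/seteqP; split => w XB i _ /=.
    by have := XB (g i) Logic.I; rewrite gK.
  by have := XB (f i) Logic.I; rewrite /= fK.
rewrite iX//= (reindex f)/=; last by exists g => ? _; [exact: fK|exact: gK].
by apply: eq_bigr => j _; rewrite fK.
Qed.

Section ScaledSingularValues.
Context {R : realType} {n : nat}.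
Implicit Types (v : 'rV[R]_n) (x : 'I_n * 'I_n -> R).

(** The matrix is given as a function on pairs of indices, so that the results on Lipschitz
    functions of a finite family apply. *)
Definition avg_sv_scaled v x : R :=
  n%:R^-1 * sum_singular_values (\matrix_(i, j) x (i, j) *m diag_mx v).

Lemma avg_sv_scaled_ge0 v x : 0 <= avg_sv_scaled v x.
Proof. by rewrite mulr_ge0 ?invr_ge0// sum_singular_values_ge0. Qed.

Lemma avg_sv_scaled_lipschitz v x y (e : R) :
  (forall ij, `|x ij - y ij| <= e) ->
  avg_sv_scaled v x <=
  avg_sv_scaled v y + n%:R^-1 * n%:R ^+ 3 * (\sum_j `|v 0 j|) * e.
Proof.
move=> xye; rewrite -[_ * _ * e]mulrA -[_^-1 * _ * _]mulrA -mulrDr.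
rewrite ler_wpM2l ?invr_ge0//.
apply: sum_singular_values_lipschitz => i j.
rewrite !mul_mx_diag !mxE -mulrBl normrM mulrC ler_pM//.
by rewrite (bigD1 j)//= lerDl sumr_ge0.
Qed.

(** Permuting columns is right multiplication by a permutation matrix. Moving it past [diag_mx v]
    permutes [v], and as an orthogonal right factor it then leaves the singular values unchanged. *)
Lemma avg_sv_scaled_perm v x (s : {perm 'I_n}) :
  avg_sv_scaled v (fun ij => x (ij.1, s ij.2)) =
  avg_sv_scaled (\row_j v 0 (s^-1%g j)) x.
Proof.
congr (_ * _); rewrite -[RHS](@sum_singular_values_orthor _ _ _ (perm_mx s^-1)).
  congr sum_singular_values; rewrite -col_permE; apply/matrixP => i j.
  by rewrite !mul_mx_diag !mxE permK.
by rewrite tr_perm_mx -perm_mxM mulgV perm_mx1.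
Qed.

Lemma avg_sv_scaled_avg m (v : 'I_m -> 'rV[R]_n) x :
  (forall i, \sum_k v k 0 i ^+ 2 = m%:R) ->
  \sum_k avg_sv_scaled (v k) x <= m%:R * avg_sv_scaled (const_mx 1) x.
Proof.
move=> vm; rewrite -mulr_sumr mulrCA ler_wpM2l ?invr_ge0//.
by rewrite diag_const_mx mulmx1 sum_singular_values_avg.
Qed.

End ScaledSingularValues.

Lemma sum_cyclic_shifts (R : nmodType) n (f : 'I_n.+1 -> R) i :
  \sum_(k < n.+1) f (i + k) = \sum_k f k.
Proof. by rewrite [RHS](reindex_inj (@addrI _ i)). Qed.

(** The factor [n.+1] is finite and positive, so it cancels even when [a] or [b] is infinite. *)
Lemma le_of_sum_le (R : realType) n (f : 'I_n.+1 -> \bar R) (a b : \bar R) :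
  (forall k, f k = a) -> (\sum_k f k <= n.+1%:R%:E * b)%E -> (a <= b)%E.
Proof.
move=> fa; under eq_bigr do rewrite fa.
rewrite sumr_const card_ord -[(a *+ _)%R]/(a *+ _)%E.
by rewrite -mule_natl lee_pmul2l// lte_fin ltr0n.
Qed.

Section ExpectedScaledSingularValues.
Context {R : realType} {d : measure_display} {T : measurableType d} {n : nat}.
Variables (P : probability T R) (X : 'I_n * 'I_n -> T -> R).
Hypothesis mX : forall ij, measurable_fun setT (X ij).
Implicit Types v : 'rV[R]_n.

Lemma measurable_avg_sv_scaled v :
  measurable_fun setT (fun w => avg_sv_scaled v (X^~ w)).
Proof. exact: (measurable_fun_lipschitz (avg_sv_scaled_lipschitz v) mX). Qed.

Hypothesis iX : mutually_independent P X.
Hypothesis idX : forall ij kl B, measurable B ->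
  P (X ij @^-1` B) = P (X kl @^-1` B).

(** Permuting [v] amounts to permuting the columns of the random matrix. Its entries stay
    independent with the same marginals, so the comparison of integrals applies in both
    directions. *)
Lemma integral_avg_sv_scaled_perm v (s : {perm 'I_n}) :
  (\int[P]_w (avg_sv_scaled (\row_j v 0 (s j)) (X^~ w))%:E =
   \int[P]_w (avg_sv_scaled v (X^~ w))%:E)%E.
Proof.
pose c (ij : 'I_n * 'I_n) : 'I_n * 'I_n := (ij.1, s^-1%g ij.2).
have cbij : bijective c.
  exists (fun ij => (ij.1, s ij.2)) => -[i j]; first by rewrite /c /= permKV.
  by rewrite /c /= permK.
have iXc := mutually_independent_reindex cbij iX.
have mXc ij : measurable_fun setT (X (c ij)) by exact: mX.
have idXc ij B : measurable B -> P (X (c ij) @^-1` B) = P (X ij @^-1` B).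
  exact: idX.
have idXc' ij B : measurable B -> P (X ij @^-1` B) = P (X (c ij) @^-1` B).
  exact: idX.
have sE : \row_j v 0 (s j) = \row_j v 0 (s^-1^-1%g j).
  by apply/rowP => j; rewrite !mxE invgK.
have Xs : (fun w => (avg_sv_scaled (\row_j v 0 (s j)) (X^~ w))%:E) =
    (fun w => (avg_sv_scaled v (fun ij => X (c ij) w))%:E).
  apply/funext => w; congr EFin; rewrite sE.
  exact: esym (avg_sv_scaled_perm v (X^~ w) s^-1).
rewrite Xs; apply: le_anti; apply/andP; split.
  exact: (le_integral_same_law (avg_sv_scaled_ge0 v)
    (avg_sv_scaled_lipschitz v) mXc mX iXc iX idXc).
exact: (le_integral_same_law (avg_sv_scaled_ge0 v)
  (avg_sv_scaled_lipschitz v) mX mXc iX iXc idXc').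
Qed.

Lemma integral_avg_sv_scaled_avg m (v : 'I_m -> 'rV[R]_n) :
  (forall i, \sum_k v k 0 i ^+ 2 = m%:R) ->
  (\sum_(k < m) \int[P]_w (avg_sv_scaled (v k) (X^~ w))%:E <=
   m%:R%:E * \int[P]_w (avg_sv_scaled (const_mx 1) (X^~ w))%:E)%E.
Proof.
move=> vm.
have mavg u : measurable_fun setT (fun w => (avg_sv_scaled u (X^~ w))%:E).
  exact/measurable_EFinP/measurable_avg_sv_scaled.
have avg0 u w : setT w -> (0 <= (avg_sv_scaled u (X^~ w))%:E)%E.
  by rewrite lee_fin avg_sv_scaled_ge0.
rewrite -(ge0_integral_sum P measurableT (fun k => mavg (v k))
  (fun k => avg0 (v k))).
rewrite -(ge0_integralZl P measurableT (mavg _) (avg0 _))//.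
apply: ge0_le_integral => //.
- by move=> w _; rewrite sume_ge0// => k _; exact: avg0.
- exact: emeasurable_sum.
- exact: measurable_funeM.
- by move=> w _; rewrite sumEFin -EFinM lee_fin avg_sv_scaled_avg.
Qed.

End ExpectedScaledSingularValues.

Theorem theorem6 (R : realType) (d0 : measure_display) (T : measurableType d0)
    (P : probability T R) (d : nat) (G : T -> 'M[R]_d) :
  (0 < d)%N ->
  mutually_independent P (fun ij : 'I_d * 'I_d => fun w => G w ij.1 ij.2) ->
  (forall i j, normally_distributed P (fun w => G w i j) 0 (Num.sqrt (d%:R^-1))) ->
  (exists2 D : 'M[R]_d, admissible_diag D &
     expected_avg_sv P G D = expected_avg_sv P G 1%:M) /\
  (forall D : 'M[R]_d, admissible_diag D ->
     (expected_avg_sv P G D <= expected_avg_sv P G 1%:M)%E).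
Proof.
(* Writing the size as [n.+1] gives the indices their addition modulo [n.+1], used for the cyclic
   shifts. *)
case: d G => [G|n G _ iG nG]; first by rewrite ltnn.
split.
  exists 1%:M => //; split; first exact: scalar_mx_is_diag.
  split=> [i|]; first by rewrite mxE eqxx.
  transitivity (\sum_(i < n.+1) (1 : R)); last by rewrite sumr_const card_ord.
  apply: eq_bigr => i _; rewrite (bigD1 i)//= big1 ?addr0 => [|j ji].
    by rewrite mxE eqxx expr1n.
  by rewrite mxE eq_sym (negbTE ji) expr0n.
move=> D [Ddiag [_ Dnorm]].
have [v vE] : exists v, v = \row_i D i i by eexists.
have DE : D = diag_mx v.
  apply/matrixP => i j; rewrite vE !mxE; have [->//|ij] := eqVneq i j.
  by move/is_diag_mxP : Ddiag; exact.
have vnorm : \sum_i v 0 i ^+ 2 = n.+1%:R.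
  rewrite -Dnorm; apply: eq_bigr => i _; rewrite (bigD1 i)//= big1 ?addr0.
    by rewrite vE mxE.
  move=> j ji; move/is_diag_mxP : Ddiag => ->; rewrite ?expr0n//.
  by rewrite eq_sym.
pose X (ij : 'I_n.+1 * 'I_n.+1) w := G w ij.1 ij.2.
have mX ij : measurable_fun setT (X ij) by have [] := nG ij.1 ij.2.
have idX ij kl B : measurable B -> P (X ij @^-1` B) = P (X kl @^-1` B).
  move=> mB; have [_ /(_ B mB) Xij] := nG ij.1 ij.2.
  by have [_ /(_ B mB) Xkl] := nG kl.1 kl.2; exact: etrans Xij (esym Xkl).
have EE u : expected_avg_sv P G (diag_mx u) =
    (\int[P]_w (avg_sv_scaled u (X^~ w))%:E)%E.
  have GX w : \matrix_(i, j) X (i, j) w = G w by apply/matrixP => i j; rewrite mxE.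
  by congr integral; apply/funext => w; rewrite /avg_sv_scaled GX.
(* [vs k] is the cyclic shift with entries [v (j + k)]. *)
pose vs (k : 'I_n.+1) := \row_j v 0 (perm (@addIr 'I_n.+1 k) j).
have Evs k := integral_avg_sv_scaled_perm mX iG idX v (perm (@addIr 'I_n.+1 k)).
have := EE v; rewrite -DE => ->; have := EE (const_mx 1).
rewrite diag_const_mx => ->.
(* For a fixed column [i], the entry [v (i + k)] runs over all of [v] as [k] varies, so the sum is
   the squared Frobenius norm of [D]. *)
have vsnorm i : \sum_k vs k 0 i ^+ 2 = n.+1%:R.
  rewrite -vnorm -(sum_cyclic_shifts (fun k => v 0 k ^+ 2) i).
  by apply: eq_bigr => k _; rewrite mxE permE.
exact: le_of_sum_le Evs (integral_avg_sv_scaled_avg P mX vsnorm).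
Qed.
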